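(* For all integers $d,k,\kappa\ge 1$ and every real $\delta>0$ there exists a constant $c=c(d,\delta,k,\kappa)>0$ such that the following holds. Let $n\ge k$, let $P$ be a sequence of $n$ points in general position in $\mathbb{R}^d$, let $\rho$ be a sequence of $k$ points in general position in $\mathbb{R}^d$, and let the entries of both sequences be colored with colors from $[\kappa]=\{1,\dots,\kappa\}$. Suppose that $\rho$ has density $\delta$ in $P$, i.e. at least $\delta\binom{n}{k}$ of the $k$-element subsequences of $P$ are copies of $\rho$. Then there exist pairwise disjoint subsequences $X_1,\dots,X_k$ of $P$, each with at least $c\cdot n$ points, such that $(X_1,\dots,X_k)$ has $\rho$-type transversals with respect to $P$; that is, for every choice of $x_1\in X_1,\dots,x_k\in X_k$, the sequence $(x_1,\dots,x_k)$ is a copy of $\rho$ and is a subsequence of $P$.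
   Context: A set (or sequence) of points in $\mathbb{R}^d$ is in general position if no $j\le d+1$ of them lie in a common $(j-2)$-flat (affine subspace of dimension $j-2$; in particular the points are distinct). The orientation of a $(d+1)$-tuple of points is $\chi(p_1,\dots,p_{d+1})=\operatorname{sgn}\det M$, where $M$ is the $(d+1)\times(d+1)$ matrix whose $i$-th row is $(1,p_i(1),\dots,p_i(d))$, with $p_i(j)$ the $j$-th coordinate of $p_i$. Sequences are indexed from $1$; $S(i)$ is the $i$-th entry of the sequence $S$. Subsequences preserve the order of the original sequence. Two sequences $\sigma,\tau$ of $k$ points in $\mathbb{R}^d$ have the same labelled order type, written $\sigma\simeq\tau$, if $\chi(\sigma(i_1),\dots,\sigma(i_{d+1}))=\chi(\tau(i_1),\dots,\tau(i_{d+1}))$ for all $1\le i_1<\cdots<i_{d+1}\le k$. Two colored sequences $\sigma,\tau$ of $k$ points are copies of one another if $\sigma\simeq\tau$ and, for every $i\in[k]$, the color of $\sigma(i)$ equals the color of $\tau(i)$. Points of subsequences of $P$ inherit the colors they have in $P$; the colors of $P$ and of $\rho$ are assigned independently (the same point of $\mathbb{R}^d$ may have different colors in $P$ and in $\rho$). *)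

(* Defs.v *)
From HB Require Import structures.
From mathcomp Require Import all_boot all_order all_algebra.
From mathcomp Require Import reals.
Set Implicit Arguments.
Unset Strict Implicit.
Unset Printing Implicit Defensive.
Import Order.TTheory GRing.Theory Num.Theory.
Local Open Scope ring_scope.

(* A sequence of [n] points is a map [P : 'I_n -> 'rV[R]_d] and its coloring a
   map [colP : 'I_n -> 'I_kappa]. An [m]-element subsequence of [P] is given by
   a strictly increasing tuple of positions [f : {ffun 'I_m -> 'I_n}] and has
   entries [P \o f]. When the points of [P] are distinct, a subsequence of any
   length is the same thing as its set of positions, a [{set 'I_n}]. *)

Definition increasing (m n : nat) (f : {ffun 'I_m -> 'I_n}) : bool :=
  [forall i : 'I_m, forall j : 'I_m, (i < j)%N ==> (f i < f j)%N].

(* The flat through [a] with direction the row space of [U]; its dimension is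
   [\rank U], and every flat of dimension at least 0 is of this form. *)
Definition in_flat (R : realType) (d : nat) (a : 'rV[R]_d) (U : 'M[R]_d)
    (x : 'rV[R]_d) : bool :=
  (x - a <= U)%MS.

(* For [j = 1] the condition is void, the only (-1)-flat being empty; hence the
   bound [2 <= j], which makes the subtraction [j - 2] exact. *)
Definition general_position (R : realType) (d n : nat)
    (P : 'I_n -> 'rV[R]_d) : Prop :=
  forall (j : nat) (f : 'I_j -> 'I_n) (a : 'rV[R]_d) (U : 'M[R]_d),
    (2 <= j <= d.+1)%N -> injective f -> \rank U = (j - 2)%N ->
    ~ (forall i, in_flat a U (P (f i))).

Definition orientation (R : realType) (d : nat)
    (p : 'I_(1 + d) -> 'rV[R]_d) : R :=
  Num.sg (\det (\matrix_(i < 1 + d) row_mx (const_mx 1 : 'rV[R]_1) (p i))).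

Definition same_order_type (R : realType) (d k : nat)
    (sigma tau : 'I_k -> 'rV[R]_d) : bool :=
  [forall f : {ffun 'I_(1 + d) -> 'I_k}, increasing f ==>
     (orientation (sigma \o f) == orientation (tau \o f))].

Definition is_copy (R : realType) (d k kappa : nat)
    (sigma : 'I_k -> 'rV[R]_d) (colsigma : 'I_k -> 'I_kappa)
    (tau : 'I_k -> 'rV[R]_d) (coltau : 'I_k -> 'I_kappa) : bool :=
  same_order_type sigma tau && [forall i, colsigma i == coltau i].

Definition copies (R : realType) (d n k kappa : nat)
    (P : 'I_n -> 'rV[R]_d) (colP : 'I_n -> 'I_kappa)
    (rho : 'I_k -> 'rV[R]_d) (colrho : 'I_k -> 'I_kappa) :
    {set {ffun 'I_k -> 'I_n}} :=
  [set f | increasing f && is_copy (P \o f) (colP \o f) rho colrho].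

Definition has_density (R : realType) (d n k kappa : nat) (delta : R)
    (rho : 'I_k -> 'rV[R]_d) (colrho : 'I_k -> 'I_kappa)
    (P : 'I_n -> 'rV[R]_d) (colP : 'I_n -> 'I_kappa) : Prop :=
  delta * 'C(n, k)%:R <= #|copies P colP rho colrho|%:R.

Definition has_type_transversals (R : realType) (d n k kappa : nat)
    (X : 'I_k -> {set 'I_n})
    (rho : 'I_k -> 'rV[R]_d) (colrho : 'I_k -> 'I_kappa)
    (P : 'I_n -> 'rV[R]_d) (colP : 'I_n -> 'I_kappa) : Prop :=
  forall x : {ffun 'I_k -> 'I_n}, (forall i, x i \in X i) ->
    is_copy (P \o x) (colP \o x) rho colrho /\ increasing x.

(* Main.v *)
(* Call a relation on k-tuples of points homogenizable if every box contains a
   sub-box, smaller in each direction by at most a constant factor, on which the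
   relation is constant. A homogenizable relation that is dense in a box holds on
   a whole linear-sized sub-box: if the homogeneous sub-box misses the relation,
   remove it; the relation is denser by a fixed factor on one of the boxes that
   cover the rest, so this stops after boundedly many steps.

   Being a copy of rho is a Boolean combination of colors, comparisons of
   positions and signs of determinants, so it remains to homogenize the sign of a
   multilinear form sum_j y_j(t) a_j(u), where t is one point and u stands for the
   others; one then fixes one point after the other. When a_0 > 0, the form is
   nonnegative iff y_0(t) >= H(t,u), where H(t,u) is a form with one term fewer
   divided by a_0(u). Choose u0 such that H(t,u0) is close to the median of H(t,.)
   for a third of the t. By induction on the number of terms, comparisons with
   H(t,u0) are homogenizable; as they are dense, one gets a box with
   H(t,u) >= H(t,u0), and, inside any large set of t's of that box, one with
   H(t,u) <= H(t,u0). According to whether y_0(t) < H(t,u0) for most t of the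
   first box or not, the form has constant sign on a part of the first box or on
   the second one. *)
Require Import Defs.
From HB Require Import structures.
From mathcomp Require Import all_boot all_order all_algebra.
From mathcomp Require Import reals.
From mathcomp Require Import zify ring.
Set Implicit Arguments.
Unset Strict Implicit.
Unset Printing Implicit Defensive.
Import Order.TTheory GRing.Theory Num.Theory.

(** * Boxes, sub-boxes and closure properties of homogenizable relations *)

Section Boxes.

Variables (k : nat) (T : finType).
Implicit Types (V A B : 'I_k -> {set T}) (E : pred {ffun 'I_k -> T}).
Implicit Types (C : nat).

Definition box V : {set {ffun 'I_k -> T}} :=
  [set x : {ffun 'I_k -> T} | [forall i, x i \in V i]].

(** The multiplicative form avoids division and forces [A i] to be nonempty whenever [V i] is. *)
Definition fraction C V A : Prop :=
  forall i, A i \subset V i /\ #|V i| <= C * #|A i|.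

(** The sides of [V] may overlap or coincide, so the box of all tuples is allowed. *)
Definition homogenizable C E : Prop :=
  forall V, exists2 A, fraction C V A & exists b, {in box A, forall x, E x = b}.

Lemma in_boxP V (x : {ffun 'I_k -> T}) :
  reflect (forall i, x i \in V i) (x \in box V).
Proof. by rewrite inE; apply: forallP. Qed.

Lemma card_box V : #|box V| = \prod_i #|V i|.
Proof.
have -> : #|box V| = #|(family (fun i => [in V i]) : pred {dffun _})|.
  by apply: eq_card => x; rewrite inE.
by rewrite card_family foldrE big_map big_enum.
Qed.

Lemma box_neq0 V x i : x \in box V -> 0 < #|V i|.
Proof. by move=> /in_boxP/(_ i) xi; apply/card_gt0P; exists (x i). Qed.

Lemma fraction_refl V : fraction 1 V V.
Proof. by move=> i; rewrite mul1n. Qed.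

Lemma fraction_trans C1 C2 V A B :
  fraction C1 V A -> fraction C2 A B -> fraction (C1 * C2) V B.
Proof.
move=> VA AB i; have [sVA cVA] := VA i; have [sAB cAB] := AB i.
split; first exact: subset_trans sAB sVA.
by rewrite -mulnA (leq_trans cVA) // leq_mul2l cAB orbT.
Qed.

Lemma fraction_le C1 C2 V A : C1 <= C2 -> fraction C1 V A -> fraction C2 V A.
Proof.
move=> le12 VA i; have [sVA cVA] := VA i; split=> //.
by rewrite (leq_trans cVA) // leq_mul2r le12 orbT.
Qed.

Lemma fraction_box C V A : fraction C V A -> box A \subset box V.
Proof.
move=> VA; apply/subsetP => x /in_boxP xA; apply/in_boxP => i.
by have [/subsetP sVA _] := VA i; apply: sVA.
Qed.

Lemma homog_le C1 C2 E : C1 <= C2 -> homogenizable C1 E -> homogenizable C2 E.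
Proof. by move=> le12 E1 V; have [A /(fraction_le le12)] := E1 V; exists A. Qed.

Lemma homog_ext C E E' : homogenizable C E -> E =1 E' -> homogenizable C E'.
Proof.
by move=> hE EE' V; have [A VA [b Eb]] := hE V; exists A => //; exists b => x /Eb <-.
Qed.

Lemma homog_const (b : bool) : homogenizable 1 (fun=> b).
Proof. by move=> V; exists V; [exact: fraction_refl | exists b]. Qed.

Lemma homog_joint C1 C2 E1 E2 V :
  homogenizable C1 E1 -> homogenizable C2 E2 ->
  exists2 A, fraction (C1 * C2) V A &
    exists b1 b2, {in box A, forall x, E1 x = b1 /\ E2 x = b2}.
Proof.
move=> h1 h2; have [A1 VA [b1 E1b]] := h1 V; have [A2 AA [b2 E2b]] := h2 A1.
exists A2; first exact: fraction_trans VA AA.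
exists b1, b2 => x xA; split; last exact: E2b.
by apply: E1b; apply: subsetP x xA; apply: fraction_box AA.
Qed.

Lemma homog_comb C1 C2 E1 E2 (op : bool -> bool -> bool) :
  homogenizable C1 E1 -> homogenizable C2 E2 ->
  homogenizable (C1 * C2) (fun x => op (E1 x) (E2 x)).
Proof.
move=> h1 h2 V; have [A VA [b1 [b2 Eb]]] := homog_joint V h1 h2.
by exists A => //; exists (op b1 b2) => x /Eb[-> ->].
Qed.

Lemma homog_forall (J : finType) C (E : J -> pred {ffun 'I_k -> T}) :
  (forall j, homogenizable C (E j)) ->
  homogenizable (C ^ #|J|) (fun x => [forall j, E j x]).
Proof.
move=> hE; apply: (@homog_ext _ (fun x => all (fun j => E j x) (enum J))); last first.
  move=> x; apply/allP/forallP => [h j | h j _]; last exact: h.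
  by apply: h; rewrite mem_enum.
rewrite cardE; elim: (enum J) => [|j s IHs] /=; first exact: homog_const.
by rewrite expnS; apply: (homog_comb andb).
Qed.

(** Keep on side [i] the more frequent of the two values of [q]. *)
Lemma homog_unary (q : pred T) (i : 'I_k) :
  homogenizable 2 (fun x => q (x i)).
Proof.
move=> V; pose Q b := [set t in V i | q t == b].
have [b Qb] : exists b, #|V i| <= 2 * #|Q b|.
  have : #|V i| = #|Q true| + #|Q false|.
    rewrite -(cardsID (Q true) (V i)); congr (_ + _); apply: eq_card => t;
      by rewrite !inE; case: (t \in V i); case: (q t).
  by have [le10 ->|lt01 ->] := leqP #|Q true| #|Q false|; [exists false | exists true]; lia.
exists (fun j => if j == i then Q b else V j).
  move=> j; case: eqP => [->|_]; last by split=> //; lia.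
  by split=> //; apply/subsetP => t; rewrite inE => /andP[].
by exists b => x /in_boxP/(_ i); rewrite eqxx inE => /andP[_ /eqP].
Qed.

End Boxes.

(** * Density increment *)

(** Taking only half of [A] leaves a large complement to continue in. Rounding up keeps [A']
    nonempty if [A] is; the factor 3 and the case of an empty complement pay for the rounding. *)
Lemma exists_half (T : finType) (C : nat) (V A : {set T}) :
  A \subset V -> #|V| <= C * #|A| ->
  exists A' : {set T}, [/\ A' \subset A, #|V| <= 2 * C * #|A'| &
    V :\: A' = set0 \/ #|V| <= 3 * #|V :\: A'|].
Proof.
move=> sAV cAV; pose s := take (uphalf #|A|) (enum A).
have us : uniq s by rewrite take_uniq ?enum_uniq.
have cs : #|[set x in s]| = uphalf #|A|.
  by rewrite cardsE (card_uniqP us) size_takel // -cardE; lia.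
have sA : [set x in s] \subset A.
  by apply/subsetP => x; rewrite inE => /mem_take; rewrite mem_enum.
have sV := subset_trans sA sAV; exists [set x in s]; rewrite cs; split=> //.
  by rewrite (leq_trans cAV) // -mulnA mulnCA leq_mul2l; apply/orP; right; lia.
have := cardsID [set x in s] V; rewrite (setIidPr sV) cs.
have := subset_leq_card sAV.
have [|c0] := posnP #|V :\: [set x in s]|; first by move=> /eqP; rewrite cards_eq0 => /eqP; left.
by right; lia.
Qed.

(** Bernoulli's inequality for [(1 + 1/p) ^ t], multiplied by [p ^ t * p]. *)
Lemma bernoulli_nat (p t : nat) : p ^ t * (p + t) <= p.+1 ^ t * p.
Proof.
elim: t => [|t IHt]; first by rewrite !expn0 addn0.
rewrite !expnS; have := leq_mul (leqnn p.+1) IHt.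
by move: (p ^ t) (p.+1 ^ t) => a b; nia.
Qed.

Lemma expn_dominates (N q : nat) : 0 < q ->
  exists t, q.-1 ^ t * N < q ^ t.
Proof.
case: q => //= -[|p] _; first by exists 1; rewrite mul0n.
(* Here [q = p.+2]; dividing Bernoulli's inequality by [p.+1] gives
   [p.+1 ^ t * (N + 1) <= p.+2 ^ t]. *)
exists (N * p.+1); have := bernoulli_nat p.+1 (N * p.+1).
have : 0 < p.+1 ^ (N * p.+1) by rewrite expn_gt0.
by move: (_ ^ _) (_ ^ _) => a b; nia.
Qed.

Section Density.

Variables (k : nat) (T : finType).
Implicit Types (V A : 'I_k -> {set T}) (E : pred {ffun 'I_k -> T}).

Definition upd (S : Type) (f : 'I_k -> S) (i : 'I_k) (s : S) (j : 'I_k) : S :=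
  if j == i then s else f j.

Lemma updE S (f : 'I_k -> S) i s : upd f i s i = s.
Proof. by rewrite /upd eqxx. Qed.

Lemma updN S (f : 'I_k -> S) i s j : j != i -> upd f i s j = f j.
Proof. by rewrite /upd => /negbTE->. Qed.

Lemma in_box_upd V i (B : {set T}) (x : {ffun 'I_k -> T}) :
  B \subset V i ->
  (x \in box (upd V i B)) = (x \in box V) && (x i \in B).
Proof.
move=> /subsetP sBV; apply/in_boxP/andP => [xV | [/in_boxP xV xB] j].
  split; last by have := xV i; rewrite updE.
  apply/in_boxP => j; have := xV j; rewrite /upd.
  by case: eqP => // ->; apply: sBV.
by rewrite /upd; case: eqP => // ->.
Qed.

Definition mix V A (l : nat) (j : 'I_k) : {set T} := if j < l then A j else V j.

(* Replacing one coordinate of V by that of A at a time splits box V \ box A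
   into the k boxes upd (mix V A l) l (V l :\: A l). *)
Lemma exists_dense_piece V A E (a b : nat) :
    (forall i, A i \subset V i) -> {in box A, forall x, ~~ E x} ->
    a * (#|box V| - #|box A|) < b * #|[set x in box V | E x]| ->
  exists l : 'I_k, let W := upd (mix V A l) l (V l :\: A l) in
    a * #|box W| < b * #|[set x in box W | E x]|.
Proof.
move=> sAV nE lt; apply/existsP; apply: contraTT lt; rewrite -leqNgt.
move=> /existsPn/(_ _)/negP hW.
pose e V' := #|[set x in box V' | E x]|.
have split_mix l (lk : l < k) (Q : pred {ffun 'I_k -> T}) :
    let W := upd (mix V A l) (Ordinal lk) (V (Ordinal lk) :\: A (Ordinal lk)) in
    #|[set x in box (mix V A l) | Q x]| =
    #|[set x in box (mix V A l.+1) | Q x]| + #|[set x in box W | Q x]|.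
  set L := Ordinal lk => W.
  have mixL : mix V A l L = V L by rewrite /mix ltnn.
  have inS x : (x \in box (mix V A l.+1)) = (x \in box (mix V A l)) && (x L \in A L).
    apply/in_boxP/andP => [xV | [/in_boxP xV xA] j].
      split; last by have := xV L; rewrite /mix ltnSn.
      apply/in_boxP => j; have := xV j; rewrite /mix ltnS leq_eqVlt.
      case: eqP => [jl|//]; have -> : j = L by apply: val_inj.
      by rewrite ltnn; apply: (subsetP (sAV L)).
    rewrite /mix ltnS leq_eqVlt; case: eqP => [jl|_]; last exact: xV.
    by have -> : j = L by apply: val_inj.
  have inW x : (x \in box W) = (x \in box (mix V A l)) && (x L \notin A L).
    rewrite in_box_upd ?mixL ?subsetDl //; case: in_boxP => //= xV.
    by have := xV L; rewrite mixL inE => ->; rewrite andbT.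
  rewrite -(cardsID [set x : {ffun 'I_k -> T} | x L \in A L]).
  congr (_ + _); apply: eq_card => x; [have := inS x | have := inW x].
    by rewrite !inE => ->; rewrite andbAC.
  by rewrite !inE => ->; rewrite andbC andbAC.
have cardT V' : #|box V'| = #|[set x in box V' | true]|.
  by apply: eq_card => x; rewrite inE andbT.
(* The negated conclusion, summed over the first [l] pieces, with terms moved across to avoid
   truncated subtraction. At [l = k] the last term vanishes because [E] misses [box A]. *)
have telescope l : l <= k ->
    b * e (mix V A 0) + a * #|box (mix V A l)| <=
    a * #|box (mix V A 0)| + b * e (mix V A l).
  elim: l => [|l IHl] lk; first by rewrite addnC.
  have := IHl (ltnW lk); have := hW (Ordinal lk); move=> /negP; rewrite -leqNgt.
  rewrite /e (cardT (mix V A l)) !(split_mix l lk) -!cardT /=.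
  lia.
have eV : box (mix V A 0) = box V by apply/setP=> x; rewrite !inE.
have eA : box (mix V A k) = box A.
  by apply/setP => x; rewrite !inE; apply: eq_forallb => j; rewrite /mix ltn_ord.
have := telescope k (leqnn k); rewrite /e eV eA.
have -> : #|[set x in box A | E x]| = 0.
  by apply: eq_card0 => x; rewrite inE; apply/andP => -[/nE/negP].
by rewrite mulnBr; lia.
Qed.

(* While the sub-box made homogeneous by homogenizable misses E, its complement
   contains a box on which E is denser by the factor q / (q - 1). *)
Lemma dense_homogenizable C (q := (2 * C).+1 ^ k) t V E :
    homogenizable C E ->
    q.-1 ^ t * #|box V| < q ^ t * #|[set x in box V | E x]| ->
  exists2 A, fraction ((2 * C + 3) ^ t) V A & {in box A, forall x, E x}.
Proof.
move=> hE; elim: t V => [|t IHt] V.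
  (* For [t = 0] the hypothesis would put more points of [E] in the box than it has points. *)
  rewrite !mul1n ltnNge subset_leq_card //.
  by apply/subsetP => x; rewrite inE => /andP[].
move=> dV; have [A0 VA0 [b Eb]] := hE V.
have /fin_all_exists[A hA] i : exists A' : {set T},
    [/\ A' \subset A0 i, #|V i| <= 2 * C * #|A'| &
        V i :\: A' = set0 \/ #|V i| <= 3 * #|V i :\: A'|].
  by have [sA cA] := VA0 i; apply: exists_half.
have sAV i : A i \subset V i.
  by have [/subset_trans sA _ _] := hA i; apply: sA; case: (VA0 i).
have VA : fraction (2 * C) V A by move=> i; have [_ cA _] := hA i; split.
have EbA x : x \in box A -> E x = b.
  move=> /in_boxP xA; apply: Eb; apply/in_boxP => i.
  by have [/subsetP sA _ _] := hA i; apply: sA.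
case: b Eb EbA => Eb EbA.
  exists A => // ; apply: fraction_le VA; rewrite expnS.
  by have : 0 < (2 * C + 3) ^ t by [rewrite expn_gt0 addn3]; nia.
have q0 : 0 < q by rewrite expn_gt0.
(* [q] has one factor [(2 * C).+1] per coordinate; the successor makes it positive even if
   [C = 0]. *)
have qA : #|box V| <= q * #|box A|.
  have -> : q = \prod_(i : 'I_k) (2 * C).+1 by rewrite prod_nat_const card_ord.
  rewrite !card_box -big_split /=.
  apply: leq_prod => i _; have [_ cA] := VA i; apply: leq_trans cA _.
  by rewrite leq_mul2r leqnSn orbT.
(* All of [E] lies outside [box A], in at most the share [(q - 1) / q] of the box; this gain lowers
   the exponent by one. *)
have [||l dW] := @exists_dense_piece V A E (q.-1 ^ t) (q ^ t) sAV.
- by move=> x /EbA->.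
- have := subset_leq_card (fraction_box VA).
  rewrite !expnS in dV; rewrite -(ltn_pmul2l q0).
  move: dV qA; case: (q) q0 => //= p _.
  set e := #|_|; set v := #|box V|; set w := #|box A|.
  move: (p ^ t) (p.+1 ^ t) => x y dV qA wv.
  rewrite [X in _ < X]mulnA; apply: leq_ltn_trans dV.
  rewrite mulnCA [p * x]mulnC -mulnA leq_mul2l; apply/orP; right.
  by rewrite mulnBr; lia.
have [B WB EB] := IHt _ dW; exists B => //; rewrite expnS.
apply: fraction_trans WB => j.
(* A piece on which [E] is dense is nonempty, so its side [l] is at least a third of [V l]. *)
have Wl : V l :\: A l != set0.
  apply: contraTneq dW => W0; rewrite -leqNgt.
  suff -> : #|[set x in box (upd (mix V A l) l (V l :\: A l)) | E x]| = 0 by rewrite muln0.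
  apply: eq_card0 => x; rewrite inE; apply/negP => /andP[/in_boxP/(_ l)].
  by rewrite updE W0 inE.
rewrite /upd; case: eqP => [->|_].
  have [_ _ [W0|c]] := hA l; first by rewrite W0 eqxx in Wl.
  by split; [apply: subsetDl | nia].
rewrite /mix; case: ifP => _; last by split=> //; nia.
by have [sA c] := VA j; split=> //; nia.
Qed.

End Density.

(** The number [t] of increments is determined by [k], [C], [N], so [K] is uniform in [T], [E],
    [V]. *)
Lemma exists_full_box (k C N : nat) : exists K, forall (T : finType)
    (E : pred {ffun 'I_k -> T}) (V : 'I_k -> {set T}),
    homogenizable C E -> 0 < #|box V| ->
    #|box V| <= N * #|[set x in box V | E x]| ->
  exists2 A, fraction K V A & {in box A, forall x, E x}.
Proof.
have [|t Ht] := @expn_dominates N ((2 * C).+1 ^ k); first by rewrite expn_gt0.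
exists ((2 * C + 3) ^ t) => T E V hE V0 dV; apply: dense_homogenizable hE _.
have : 0 < #|[set x in box V | E x]|.
  by rewrite lt0n; apply: contraTneq dV => ->; rewrite muln0 -ltnNge.
move: dV Ht; move: (_ ^ t) ((2 * C).+1 ^ k ^ t) => x y; nia.
Qed.

(** * Approximate medians, fibers and comparison with a threshold *)

Section Median.

Variables (R : realFieldType) (S : finType).
Implicit Types (U : {set S}) (h : S -> R).

(** Take the element of this set with the least [h]: the whole set lies at or above it, yet less
    than a third of [U] does. *)
Lemma few_top U h :
  3 * #|[set u in U | 3 * #|[set v in U | (h u <= h v)%R]| < #|U|]| <= #|U|.
Proof.
set B := [set u in U | _]; have [->|[u0 u0B]] := set_0Vmem B.
  by rewrite cards0 muln0.
case: (@arg_minP _ _ _ u0 [in B] h u0B) => u uB umin.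
have : u \in B by []. rewrite inE => /andP[_ /ltnW]; apply: leq_trans.
rewrite leq_mul2l; apply: subset_leq_card; apply/subsetP => v vB.
by rewrite inE umin // andbT; move: vB; rewrite inE => /andP[].
Qed.

(** Asking for a third instead of a half on each side makes medians abundant. *)
Definition median U h (u : S) : bool :=
  (#|U| <= 3 * #|[set v in U | (h u <= h v)%R]|) &&
  (#|U| <= 3 * #|[set v in U | (h v <= h u)%R]|).

Lemma many_medians U h : #|U| <= 3 * #|[set u in U | median U h u]|.
Proof.
set M := [set u in U | _].
pose B1 := [set u in U | 3 * #|[set v in U | (h u <= h v)%R]| < #|U|].
pose B2 := [set u in U | 3 * #|[set v in U | (h v <= h u)%R]| < #|U|].
have cB1 : 3 * #|B1| <= #|U| by apply: few_top.
have cB2 : 3 * #|B2| <= #|U|.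
  apply: leq_trans (few_top U (fun u => - h u)%R).
  rewrite leq_mul2l; apply: subset_leq_card; apply/subsetP => u.
  rewrite !inE => /andP[-> /=]; congr (_ < _); congr (3 * _).
  by apply: eq_card => v; rewrite !inE lerN2.
have : #|U| <= #|M| + (#|B1| + #|B2|).
  apply: leq_trans (leq_add (leqnn _) (leq_card_setU _ _)).
  apply: leq_trans (leq_card_setU _ _); apply: subset_leq_card.
  apply/subsetP => u uU; rewrite !inE uU /= /median.
  by case: leqP => //=; case: leqP => //=; rewrite ?orbT.
lia.
Qed.

(** Double counting of the pairs [(t, u)] with [u] a median of [H t]. *)
Lemma common_median (T : finType) (A : {set T}) U (H : T -> S -> R) :
  0 < #|U| ->
  exists2 u, u \in U & #|A| <= 3 * #|[set t in A | median U (H t) u]|.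
Proof.
move=> U0; apply/exists_inP; apply: contraLR (leqnn (#|A| * #|U|)).
rewrite negb_exists_in => /forall_inP few; rewrite -ltnNge.
have swap : \sum_(t in A) #|[set u in U | median U (H t) u]| =
            \sum_(u in U) #|[set t in A | median U (H t) u]|.
  under eq_bigr => t _ do rewrite -sum1dep_card.
  under [RHS]eq_bigr => u _ do rewrite -sum1dep_card.
  rewrite (exchange_big_dep [in U]) /=; last by move=> t u _ /andP[].
  by apply: eq_bigr => u uU; apply: eq_bigl => t; rewrite uU.
apply: (@leq_ltn_trans (\sum_(t in A) 3 * #|[set u in U | median U (H t) u]|)).
  by rewrite -sum_nat_const; apply: leq_sum => t _; apply: many_medians.
rewrite -big_distrr /= swap big_distrr /= mulnC -sum_nat_const.
have /card_gt0P[u uU] := U0.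
rewrite (bigD1 u) //= [X in _ < X](bigD1 u) //= -addSn leq_add //.
  by rewrite ltnNge few.
by apply: leq_sum => v /andP[vU _]; rewrite ltnW // ltnNge few.
Qed.

End Median.

Section Fibers.

Variables (k : nat) (T : finType) (i : 'I_k) (V : 'I_k -> {set T}).
Variable Q : T -> pred {ffun 'I_k -> T}.

Hypothesis Q_indep : forall t (x x' : {ffun 'I_k -> T}),
  (forall j, j != i -> x j = x' j) -> Q t x = Q t x'.

(** Since [Q t] ignores coordinate [i], it is as dense in the slice [x i = t] as in the whole box;
    sum over [t] in [B]. *)
Lemma card_fiberwise (N : nat) (B : {set T}) :
    B \subset V i ->
    {in B, forall t, #|box V| <= N * #|[set x in box V | Q t x]|} ->
  #|box (upd V i B)| <= N * #|[set x in box (upd V i B) | Q (x i) x]|.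
Proof.
move=> sBV dQ; set E := [set x in _ | _].
have [/eqP|Vi0] := posnP #|V i|.
  rewrite cards_eq0 => /eqP Vi0; rewrite Vi0 subset0 in sBV.
  rewrite card_box (bigD1 i) //= updE (eqP sBV) cards0 mul0n //.
pose F := [set p : T * {ffun 'I_k -> T} | [&& p.1 \in B, p.2 \in box V & Q p.1 p.2]].
have cF : #|B| * #|box V| <= N * #|F|.
  have -> : #|F| = \sum_(t in B) #|[set x in box V | Q t x]|.
    rewrite -sum1dep_card; under [RHS]eq_bigr => t _ do rewrite -sum1dep_card.
    by rewrite pair_big_dep /=; apply: eq_bigl => -[t x].
  by rewrite big_distrr /= -sum_nat_const; apply: leq_sum.
have cE : #|F| <= #|E| * #|V i|.
  rewrite -cardsX.
  (* Exchanging [t] with coordinate [i] of [x] is injective and maps [F] into the product of [E] and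
     [V i]. *)
  pose sw (p : T * {ffun 'I_k -> T}) := ([ffun j => upd p.2 i p.1 j], p.2 i).
  have sw_inj : injective sw.
    move=> [t x] [t' x'] /pair_eqP/andP[/eqP/ffunP e /eqP xi]; have := e i.
    rewrite !ffunE !updE /= => ->; congr (_, _); apply/ffunP => j.
    have := e j; rewrite !ffunE /=; have [->//|ji] := eqVneq j i.
    by rewrite !updN.
  rewrite -(card_imset (mem F) sw_inj).
  apply: subset_leq_card; apply/subsetP => _ /imsetP[[t x] tx ->].
  move: tx; rewrite inE /= => /and3P[tB /in_boxP xV Qtx]; rewrite inE /= xV andbT inE.
  apply/andP; split; last first.
    rewrite ffunE updE (@Q_indep _ _ x) // => j ji.
    by rewrite ffunE updN.
  by apply/in_boxP => j; rewrite ffunE /upd; case: eqP => // ->.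
have cV : #|box (upd V i B)| * #|V i| = #|B| * #|box V|.
  rewrite !card_box (bigD1 i) //= [in RHS](bigD1 i) //= updE.
  have -> : \prod_(j | j != i) #|upd V i B j| = \prod_(j | j != i) #|V j|.
    by apply: eq_bigr => j ji; rewrite updN.
  by rewrite -mulnA; congr (_ * _); rewrite mulnC.
rewrite -(leq_pmul2r Vi0) cV -mulnA; apply: leq_trans cF _.
by rewrite leq_mul2l cE orbT.
Qed.

End Fibers.

(** [Ge] and [Le] have to agree with the comparisons on [box V] only, because [H] will be a quotient
    whose denominator is known to be positive only there. *)
Lemma threshold_homog (k C : nat) : exists C', forall (R : realFieldType)
    (T : finType) (i : 'I_k) (V : 'I_k -> {set T})
    (H : T -> {ffun 'I_k -> T} -> R) (g : T -> R)
    (Ge Le : {ffun 'I_k -> T} -> pred {ffun 'I_k -> T}),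
    (forall t (x x' : {ffun 'I_k -> T}),
       (forall j, j != i -> x j = x' j) -> H t x = H t x') ->
    (forall u, u \in box V -> homogenizable C (Ge u)) ->
    (forall u, u \in box V -> homogenizable C (Le u)) ->
    {in box V &, forall u x, Ge u x = (H (x i) u <= H (x i) x)%R} ->
    {in box V &, forall u x, Le u x = (H (x i) x <= H (x i) u)%R} ->
  exists2 A, fraction C' V A &
    exists b, {in box A, forall x : {ffun 'I_k -> T}, (H (x i) x <= g (x i))%R = b}.
Proof.
have [K HK] := exists_full_box k C 3.
(* On side [i]: 3 for [Y], 2 for [L] or its complement, and one or two factors [K]. The successor
   covers an empty box, where [V] itself is returned. *)
exists (6 * (K * K + K)).+1 => R T i V H g Ge Le Hi hGe hLe GeE LeE.
have [V0|] := posnP #|box V|.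
  exists V => [j|]; first by split=> //; lia.
  by exists true => x; rewrite (card0_eq V0).
move=> /(common_median (V i) H)[u uV]; set Y := [set t in V i | _] => cY.
have sYV : Y \subset V i by apply/subsetP => t; rewrite inE => /andP[].
(* A comparison that is dense for each fixed [t] in [B] holds on a sub-box of [upd V i B]. Used with
   [B = Y], then with [B = L]. *)
have full (B : {set T}) (E : pred {ffun 'I_k -> T}) (Q : T -> pred {ffun 'I_k -> T}) :
    B \subset Y -> 0 < #|B| -> homogenizable C E ->
    (forall t (x x' : {ffun 'I_k -> T}),
       (forall j, j != i -> x j = x' j) -> Q t x = Q t x') ->
    {in B, forall t, #|box V| <= 3 * #|[set x in box V | Q t x]|} ->
    {in box V, forall x : {ffun 'I_k -> T}, E x = Q (x i) x} ->
    exists2 A, fraction K (upd V i B) A & {in box A, forall x, E x}.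
  move=> sBY B0 hE Qi dQ EQ; have sBV := subset_trans sBY sYV.
  apply: HK => //.
    have /card_gt0P[t tB] := B0.
    pose x : {ffun 'I_k -> T} := [ffun j => upd u i t j].
    suff xB : x \in box (upd V i B) by apply/card_gt0P; exists x.
    apply/in_boxP => j; rewrite ffunE /upd; case: eqP => // _.
    exact: in_boxP.
  apply: leq_trans (card_fiberwise Qi sBV dQ) _.
  rewrite leq_mul2l; apply: subset_leq_card; apply/subsetP => x.
  move=> /setIdP[xW Qx]; apply/setIdP; split=> //.
  by move: xW; rewrite in_box_upd // => /andP[xV _]; rewrite EQ.
have Y0 : 0 < #|Y| by have := box_neq0 i uV; lia.
have [|||A VA GeA] := full Y (Ge u) (fun t x => H t u <= H t x)%R (subxx Y) Y0 (hGe u uV).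
- by move=> t x x' /(Hi t)->.
- by move=> t; rewrite inE => /andP[_ /andP[]].
- by move=> x xV; rewrite GeE.
have sAY : A i \subset Y by have [] := VA i; rewrite updE.
have cYA : #|Y| <= K * #|A i| by have [_] := VA i; rewrite updE.
have sAV j : A j \subset V j.
  by have [] := VA j; rewrite /upd; case: eqP => [->|//] /subset_trans->.
(* If [L] is at least half of [A i], a second box gives [H t x <= H t u <= g t]; otherwise
   [g t < H t u <= H t x] on the rest of [A i]. *)
pose L := [set t in A i | (H t u <= g t)%R].
have [cL|cL] := leqP #|A i| (2 * #|L|).
  have sLY : L \subset Y.
    by apply: subset_trans sAY; apply/subsetP => t; rewrite inE => /andP[].
  have L0 : 0 < #|L| by nia.
  have [|||B LB LeB] := full L (Le u) (fun t x => H t x <= H t u)%R sLY L0 (hLe u uV).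
  - by move=> t x x' /(Hi t)->.
  - by move=> t /(subsetP sLY); rewrite inE => /andP[_ /andP[]].
  - by move=> x xV; rewrite LeE.
  have sBL : B i \subset L by have [] := LB i; rewrite updE.
  have sBV j : B j \subset V j.
    have [] := LB j; rewrite /upd; case: eqP => [->|//] /subset_trans-> //.
    exact: subset_trans sLY sYV.
  exists B => [j|].
    split=> //; have [_] := LB j; rewrite /upd; case: eqP => [->|_] c; last by nia.
    by rewrite (leq_trans cY) //; nia.
  exists true => x /in_boxP xB; have xV : x \in box V.
    by apply/in_boxP => j; apply: (subsetP (sBV j)).
  have := subsetP sBL _ (xB i); rewrite inE => /andP[_]; apply: le_trans.
  by rewrite -LeE //; apply: LeB; apply/in_boxP.
exists (upd A i (A i :\: L)) => [j|].
  have [->|ji] := eqVneq j i.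
    rewrite updE; split; first exact: subset_trans (subsetDl _ _) (sAV i).
    have := cardsID L (A i); rewrite (setIidPr _); last first.
      by apply/subsetP => t; rewrite inE => /andP[].
    move=> cA; have : K * #|A i| <= K * (2 * #|A i :\: L|).
      by rewrite leq_mul2l; apply/orP; right; lia.
    by rewrite (leq_trans cY) //; nia.
  by rewrite updN //; split=> //; have [_] := VA j; rewrite updN //; nia.
exists false => x; rewrite in_box_upd ?subsetDl // => /andP[xA].
rewrite !inE => /andP[]; have xiA : x i \in A i by apply: in_boxP.
rewrite xiA /= -ltNge => lt _; apply/negbTE; rewrite -ltNge; apply: lt_le_trans lt _.
rewrite -GeE //; first exact: GeA.
by apply/in_boxP => j; apply: (subsetP (sAV j)); apply: in_boxP.
Qed.

(** * Signs of bilinear forms *)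

Local Open Scope ring_scope.

(** The hypothesis freezes the factors [y] at constants. It survives the induction on [D]: for fixed
    [u], the coefficients comparing two thresholds are linear combinations of the [a j]. *)
Lemma bilinear_homog (k C D : nat) : exists C', forall (R : realFieldType)
    (T : finType) (i : 'I_k) (a : 'I_D -> {ffun 'I_k -> T} -> R)
    (y : 'I_D -> T -> R),
    (forall j (x x' : {ffun 'I_k -> T}),
       (forall l, l != i -> x l = x' l) -> a j x = a j x') ->
    (forall v : 'I_D -> R, homogenizable C (fun x => 0 <= \sum_j v j * a j x)) ->
  homogenizable C' (fun x => 0 <= \sum_j y j (x i) * a j x).
Proof.
elim: D => [|D [C1 IH]].
  exists 1%N => R T i a y _ _; apply: (homog_ext (homog_const true)) => x /=.
  by rewrite big_ord0 lexx.
have [C2 H2] := threshold_homog k C1.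
(* [C * C] fixes the sign of [a ord0]; then [C1] serves the zero case, [C2] the nonzero ones and 1
   the contradictory one. *)
exists (C * C * (C1 + C2).+1)%N => R T i a y ai ha V.
have pos (b : 'I_D.+1 -> {ffun 'I_k -> T} -> R) (z : 'I_D.+1 -> T -> R) W :
    (forall j (x x' : {ffun 'I_k -> T}),
       (forall l, l != i -> x l = x' l) -> b j x = b j x') ->
    (forall v : 'I_D.+1 -> R, homogenizable C (fun x => 0 <= \sum_j v j * b j x)) ->
    {in box W, forall x : {ffun 'I_k -> T}, 0 < b ord0 x} ->
    exists2 A, fraction C2 W A &
      exists s, {in box A, forall x : {ffun 'I_k -> T}, (0 <= \sum_j z j (x i) * b j x) = s}.
  move=> bi hb b0.
  pose S t x := \sum_(j < D) z (lift ord0 j) t * b (lift ord0 j) x.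
  pose H t x := - S t x / b ord0 x.
  (* Cross products that clear the denominators of [H] at [u] and at [x]; [e = 1] yields [Ge] and
     [e = -1] yields [Le]. *)
  pose c (e : R) u j x :=
    e * (b (lift ord0 j) u * b ord0 x - b (lift ord0 j) x * b ord0 u).
  pose cmp e u := [pred x : {ffun 'I_k -> T} |
    0 <= \sum_j z (lift ord0 j) (x i) * c e u j x].
  have cmpE e u x :
      cmp e u x = (0 <= e * (S (x i) u * b ord0 x - S (x i) x * b ord0 u)).
    rewrite /cmp /= /S !mulr_suml -sumrB mulr_sumr.
    by congr (_ <= _); apply: eq_bigr => j _; rewrite /c; ring.
  have hcmp e u : homogenizable C1 (cmp e u).
    apply: (IH R T i (c e u) (fun j => z (lift ord0 j))) => [j x x' xx'|v].
      by rewrite /c (bi ord0 _ _ xx') (bi (lift ord0 j) _ _ xx').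
    (* With [u] and [v] fixed, the form is a combination of the [b j x] with constant coefficients
       [w]. *)
    pose w j := if unlift ord0 j is Some j' then - e * v j' * b ord0 u
                else e * \sum_j v j * b (lift ord0 j) u.
    apply: (homog_ext (hb w)) => x /=; congr (_ <= _).
    rewrite big_ord_recl /w unlift_none mulr_sumr mulr_suml -big_split /=.
    by apply: eq_bigr => j _; rewrite liftK /c; ring.
  have Hi t (x x' : {ffun 'I_k -> T}) :
      (forall j, j != i -> x j = x' j) -> H t x = H t x'.
    move=> xx'; rewrite /H (bi ord0 _ _ xx') /S; congr (- _ / _).
    by apply: eq_bigr => j _; rewrite (bi _ _ _ xx').
  have HE u x : u \in box W -> x \in box W ->
      (H (x i) u <= H (x i) x) = (S (x i) x * b ord0 u <= S (x i) u * b ord0 x).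
    move=> /b0 u0 /b0 x0; rewrite /H !mulNr lerN2 ler_pdivrMr // mulrAC.
    by rewrite ler_pdivlMr.
  have [||A WA [s As]] := H2 R T i W H (z ord0) (cmp 1) (cmp (-1)) Hi
      (fun u _ => hcmp 1 u) (fun u _ => hcmp (-1) u).
  - by move=> u x uW xW; rewrite cmpE HE // mul1r subr_ge0.
  - move=> u x uW xW; rewrite cmpE mulN1r opprB subr_ge0.
    rewrite /H !mulNr lerN2 ler_pdivrMr ?b0 // mulrAC ler_pdivlMr ?b0 //.
  exists A => //; exists s => x xA; rewrite -(As x xA) big_ord_recl.
  have x0 := b0 x (subsetP (fraction_box WA) x xA).
  by rewrite /H ler_pdivrMr // -[RHS]subr_ge0 opprK.
have h0 e : homogenizable C (fun x => 0 <= e * a ord0 x).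
  apply: (homog_ext (ha (fun j => if j == ord0 then e else 0))) => x /=.
  by rewrite big_ord_recl eqxx big1 ?addr0 // => j _; rewrite mul0r.
have [B VB [b1 [b2 Bb]]] := homog_joint V (h0 1) (h0 (-1)).
suff [A BA hA] : exists2 A, fraction (C1 + C2).+1 B A &
      exists b, {in box A, forall x : {ffun 'I_k -> T}, (0 <= \sum_j y j (x i) * a j x) = b}.
  by exists A => //; apply: fraction_trans VB BA.
have le1 : (C1 <= (C1 + C2).+1)%N by rewrite leqW ?leq_addr.
have le2 : (C2 <= (C1 + C2).+1)%N by rewrite leqW ?leq_addl.
(* [a ord0] is zero (drop its term), positive, negative (negate both [a] and [y]), or neither weak
   inequality holds and [box B] is empty. *)
case: b1 b2 Bb => -[] Bb.
- have [||A BA [b Ab]] := IH R T i (fun j => a (lift ord0 j)) (fun j => y (lift ord0 j)) _ _ B.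
  + by move=> j x x' xx'; apply: ai.
  + move=> v; pose w j := if unlift ord0 j is Some j' then v j' else 0.
    apply: (homog_ext (ha w)) => x /=; rewrite big_ord_recl /w unlift_none mul0r add0r.
    by congr (_ <= _); apply: eq_bigr => j _; rewrite liftK.
  exists A; first exact: fraction_le BA.
  exists b => x xA; rewrite -(Ab x xA) big_ord_recl.
  have [+ +] := Bb x (subsetP (fraction_box BA) x xA).
  rewrite mul1r mulN1r oppr_ge0 => ge0 le0.
  have -> : a ord0 x = 0 by apply/eqP; rewrite eq_le ge0 le0.
  by rewrite mulr0 add0r.
- have [|A BA hA] := pos a y B ai ha; last by exists A => //; apply: fraction_le BA.
  move=> x /Bb[_]; rewrite mulN1r oppr_ge0 => /negbT; by rewrite -ltNge.
- have [|||A BA [b Ab]] := pos (fun j x => - a j x) (fun j t => - y j t) B.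
  + by move=> j x x' /(ai j)->.
  + move=> v; apply: (homog_ext (ha (fun j => - v j))) => x /=.
    by congr (_ <= _); apply: eq_bigr => j _; ring.
  + by move=> x /Bb[]; rewrite mul1r => /negbT; rewrite -ltNge oppr_gt0.
  exists A; first exact: fraction_le BA.
  exists b => x /Ab <-; congr (_ <= _); apply: eq_bigr => j _; ring.
- exists B; first by apply: fraction_le (fraction_refl B).
  exists true => x /Bb[]; rewrite mul1r mulN1r oppr_ge0 => /negbT + /negbT.
  by rewrite -!ltNge => /ltW h1 /lt_geF; rewrite h1.
Qed.

(** * Homogenizing order, orientations and copies *)

(** The relation is [0 <= x j - (x i + 1)], a form with two terms; the successor turns the strict
    inequality into a weak one. With [x i] frozen it is unary in [x j]. *)
Lemma order_homog (k : nat) : exists C, forall (n : nat) (i j : 'I_k),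
  i != j -> homogenizable C (fun x : {ffun 'I_k -> 'I_n} => (x i < x j)%N).
Proof.
have [C HC] := bilinear_homog k 2 2; exists C => n i j ij.
pose a (l : 'I_2) (x : {ffun 'I_k -> 'I_n}) : rat :=
  if l == ord0 then (x j)%:R else 1.
pose y (l : 'I_2) (t : 'I_n) : rat := if l == ord0 then 1 else - t.+1%:R.
have aE (v : 'I_2 -> rat) x :
    \sum_l v l * a l x = v ord0 * (x j)%:R + v (lift ord0 ord0).
  by rewrite big_ord_recl big_ord1 /a /= mulr1.
apply: (homog_ext (HC rat 'I_n i a y _ _)) => [l x x' xx' | v | x /=].
- by rewrite /a xx' // eq_sym.
- pose q (t : 'I_n) := 0 <= v ord0 * t%:R + v (lift ord0 ord0).
  by apply: (homog_ext (homog_unary q j)) => x; rewrite aE.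
- by rewrite (aE (y^~ (x i))) /y /= mul1r subr_ge0 ler_nat.
Qed.

Lemma cofactor_row' (R : comNzRingType) (m : nat) (A B : 'M[R]_m) i j :
  row' i A = row' i B -> cofactor A i j = cofactor B i j.
Proof.
move=> AB; rewrite /cofactor; congr (_ * \det _).
apply/matrixP => r c; have /matrixP/(_ r (lift j c)) := AB.
by rewrite !mxE.
Qed.

(* Induction on the number t of rows that still depend on x; expanding the
   determinant along the last of them reduces to constant last rows. *)
Lemma det_homog (k m t : nat) : exists C, forall (R : realFieldType)
    (T : finType) (f : 'I_m -> 'I_k) (w : T -> 'rV[R]_m) (v : 'I_m -> 'rV[R]_m)
    (e : R), injective f ->
  homogenizable C (fun x => 0 <= e *
    \det (\matrix_(r < m) if (r < t)%N then w (x (f r)) else v r)).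
Proof.
elim: t => [|t [C HC]].
  exists 1%N => R T f w v e _.
  apply: (homog_ext (homog_const (0 <= e * \det (\matrix_r v r)))) => x.
  by congr (_ <= _ * \det _); apply/matrixP => r c; rewrite !mxE.
have [tm|mt] := ltnP t m; last first.
  exists C => R T f w v e /(HC R T f w v e) h; apply: (homog_ext h) => x.
  congr (_ <= _ * \det _); apply/matrixP => r c; rewrite !mxE.
  have rt := leq_trans (ltn_ord r) mt.
  by rewrite rt leqW.
have [C' HC'] := bilinear_homog k C m; exists C' => R T f w v e f_inj.
pose r0 := Ordinal tm.
pose M (x : {ffun 'I_k -> T}) : 'M[R]_m :=
  \matrix_(r < m) if (r < t.+1)%N then w (x (f r)) else v r.
(* These cofactors omit row [r0], hence do not see [x (f r0)], as [f] is injective. *)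
pose a j x := e * cofactor (M x) r0 j.
apply: (homog_ext (HC' R T (f r0) a (fun j u => w u 0 j) _ _)) => [j x x' xx'|u|x /=].
- congr (_ * _); apply: cofactor_row'; apply/matrixP => r c; rewrite !mxE.
  by rewrite xx' // (inj_eq f_inj) eq_sym neq_lift.
(* Freezing row [r0] at [u] leaves a determinant with only [t] variable rows. *)
- pose v' r := if r == r0 then \row_j u j else v r.
  apply: (homog_ext (HC R T f w v' e f_inj)) => x; congr (_ <= _).
  rewrite (expand_det_row _ r0) mulr_sumr; apply: eq_bigr => j _.
  rewrite !mxE ltnn /v' eqxx mxE mulrCA; congr (_ * (_ * _)).
  apply: cofactor_row'; apply/matrixP => r c; rewrite !mxE ltnS.
  have rr0 : lift r0 r != r0 by rewrite eq_sym neq_lift.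
  by rewrite (negbTE rr0) [in RHS]leq_eqVlt -[_ == t]/(lift r0 r == r0) (negbTE rr0).
- congr (_ <= _); rewrite -/(M x) (expand_det_row _ r0) mulr_sumr.
  by apply: eq_bigr => j _; rewrite mxE ltnSn /a mulrCA.
Qed.

(** Recovers the sign from two weak inequalities, the form in which determinants are homogenized. *)
Lemma sgr_nneg (R : realDomainType) (u : R) :
  Num.sg u = (0 <= u)%R%:R - (0 <= - u)%R%:R.
Proof.
by rewrite oppr_ge0; case: sgrP; rewrite ?subrr ?subr0 ?sub0r.
Qed.

Lemma increasing_inj (m n : nat) (f : {ffun 'I_m -> 'I_n}) :
  increasing f -> injective f.
Proof.
move=> /forallP fi i j fij; apply: val_inj; apply/eqP.
have lt_f (a b : 'I_m) : (a < b)%N -> (f a < f b)%N.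
  by have /forallP/(_ b)/implyP := fi a.
by case: ltngtP => // /lt_f; rewrite fij ltnn.
Qed.

Lemma orientation_homog (k d : nat) : exists C, forall (R : realType) (n : nat)
    (P : 'I_n -> 'rV[R]_d) (f : {ffun 'I_(1 + d) -> 'I_k}) (s : R),
  injective f ->
  homogenizable C (fun x : {ffun 'I_k -> 'I_n} => orientation ((P \o x) \o f) == s).
Proof.
have [C HC] := det_homog k (1 + d) (1 + d); exists (C * C)%N => R n P f s f_inj.
pose w t : 'rV[R]_(1 + d) := row_mx (const_mx 1 : 'rV[R]_1) (P t).
pose g x := \det (\matrix_(r < 1 + d) if (r < 1 + d)%N then w (x (f r)) else 0).
(* All [1 + d] rows are variable, so the default row 0 never occurs. *)
have h e := HC R 'I_n f w (fun=> 0) e f_inj.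
apply: (homog_ext (homog_comb (fun b1 b2 => b1%:R - b2%:R == s) (h 1) (h (-1)))) => x /=.
rewrite mul1r mulN1r -sgr_nneg /orientation; congr (Num.sg (\det _) == s).
by apply/matrixP => r c; rewrite mxE [RHS]mxE ltn_ord.
Qed.

(** A color enters only through the test against [colrho i], at cost 2, so the constant is
    independent of [kappa]. *)
Lemma copy_homog (k d : nat) : exists C, forall (R : realType) (n kappa : nat)
    (P : 'I_n -> 'rV[R]_d) (colP : 'I_n -> 'I_kappa)
    (rho : 'I_k -> 'rV[R]_d) (colrho : 'I_k -> 'I_kappa),
  homogenizable C (fun x : {ffun 'I_k -> 'I_n} =>
    increasing x && is_copy (P \o x) (colP \o x) rho colrho).
Proof.
have [C1 H1] := order_homog k; have [C2 H2] := orientation_homog k d.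
eexists => R n kappa P colP rho colrho.
apply: (homog_comb andb); last apply: (homog_comb andb).
- apply: homog_forall => i; apply: homog_forall => j.
  (* For other pairs the implication is constantly true, with factor 1; [C1.+1] bounds both
     cases. *)
  have [ij|] := boolP (i < j)%N; last first.
    by move=> _; apply: (homog_le (ltn0Sn C1)); apply: homog_const.
  apply: homog_le (leqnSn C1) _; apply: H1.
  by apply: contraTneq ij => ->; rewrite ltnn.
- apply: homog_forall => f.
  have [fi|] := boolP (increasing f); last first.
    by move=> _; apply: (homog_le (ltn0Sn C2)); apply: homog_const.
  by apply: homog_le (leqnSn C2) _; apply/H2/increasing_inj.
- by apply: homog_forall => i; apply: (homog_unary (fun t => colP t == colrho i) i).
Qed.

(** * From density among subsequences to transversals *)

(** Multiply by the factorial of [k] and compare factors: [n * (k - i) <= (n - i) * k]. *)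
Lemma expn_bin_bound (n k : nat) : (k <= n)%N -> (n ^ k <= 'C(n, k) * k ^ k)%N.
Proof.
move=> kn; rewrite -(leq_pmul2r (fact_gt0 k)) mulnAC bin_ffact -ffactnn !ffact_prod.
have cst m : (m ^ k = \prod_(i < k) m)%N by rewrite prod_nat_const card_ord.
rewrite !cst -!big_split /=; apply: leq_prod => i _.
by rewrite mulnBr mulnBl leq_sub2l // [X in (X <= _)%N]mulnC leq_mul2r kn orbT.
Qed.

Theorem theorem1 (R : realType) (d k kappa : nat) (delta : R)
    (hd : (1 <= d)%N) (hk : (1 <= k)%N) (hkappa : (1 <= kappa)%N)
    (hdelta : 0 < delta) :
  exists2 c : R, 0 < c &
    forall (n : nat) (P : 'I_n -> 'rV[R]_d) (colP : 'I_n -> 'I_kappa)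
      (rho : 'I_k -> 'rV[R]_d) (colrho : 'I_k -> 'I_kappa),
      (k <= n)%N ->
      general_position P ->
      general_position rho ->
      has_density delta rho colrho P colP ->
      exists X : 'I_k -> {set 'I_n},
        [/\ forall i j, i != j -> [disjoint X i & X j],
            forall i, c * n%:R <= #|X i|%:R
          & has_type_transversals X rho colrho P colP].
Proof.
have [C HC] := copy_homog k d.
pose N := Num.bound delta^-1.
(* Copies make up at least the share [1 / (k ^ k * N)] of all [n ^ k] tuples: [N] bounds
   [1 / delta], and [k ^ k] passes from subsequences to tuples. *)
have [K HK] := exists_full_box k C (k ^ k * N).
exists K.+1%:R^-1; first by rewrite invr_gt0 ltr0n.
move=> n P colP rho colrho kn _ _ dens.
have n0 : (0 < n)%N := leq_trans hk kn.
have binN : ('C(n, k) <= N * #|copies P colP rho colrho|)%N.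
  rewrite -(ler_nat R) natrM; apply: le_trans (_ : delta^-1 * #|copies P colP rho colrho|%:R <= _).
    by rewrite mulrC ler_pdivlMr // mulrC.
  rewrite ler_wpM2r // ltW //; apply: archi_boundP.
  by rewrite invr_ge0 ltW.
pose V (i : 'I_k) := [set: 'I_n].
have cV : #|box V| = (n ^ k)%N.
  rewrite card_box; under eq_bigr => i _ do rewrite cardsT card_ord.
  by rewrite prod_nat_const card_ord.
have [||X VX XE] := HK _ _ V (HC R n kappa P colP rho colrho).
- by rewrite cV expn_gt0 n0.
- rewrite cV; apply: leq_trans (expn_bin_bound kn) _.
  rewrite mulnC -mulnA leq_mul2l; apply/orP; right; apply: leq_trans binN _.
  rewrite leq_mul2l; apply/orP; right; apply: subset_leq_card.
  apply/subsetP => x; rewrite inE => xE; apply/setIdP; split=> //.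
  by apply/in_boxP => i; rewrite inE.
have cX i : (n <= K * #|X i|)%N by have [_] := VX i; rewrite cardsT card_ord.
have XT : has_type_transversals X rho colrho P colP.
  by move=> x /in_boxP/XE/andP[].
exists X; split=> // [i j ij|i]; last first.
  rewrite mulrC ler_pdivrMr ?ltr0n // mulrC -natrM ler_nat.
  by apply: leq_trans (cX i) _; rewrite leq_mul2r leqnSn orbT.
apply/pred0P => p /=; apply/negbTE/negP => /andP[pi pj].
have /fin_all_exists[y yX] l : exists t, t \in X l.
  by apply/card_gt0P; have := cX l; case: #|X l| => //; rewrite muln0 leqNgt n0.
(* A common point [p] of [X i] and [X j] would give a transversal taking the value [p] twice, but
   transversals are increasing. *)
pose x : {ffun 'I_k -> 'I_n} := [ffun l => if l \in [:: i; j] then p else y l].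
have [|_ /increasing_inj xi] := XT x.
  move=> l; rewrite ffunE !inE; case: eqP => [->//|_]; case: eqP => [->//|_].
  exact: yX.
move/negP: ij; apply; apply/eqP; apply: xi.
by rewrite !ffunE !inE !eqxx orbT.
Qed.
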